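(* Let $\alpha$ be a real number with $-1<\alpha\le 47.9603$ and let $n\ge 5$ be an integer. For real $t$ define the polynomial in $x$ $$ \widehat{L}^{(\alpha)}_{n+1}(x,t)=\bigl(x-(2n+\alpha+1)\bigr)\,\widehat{L}^{(\alpha)}_{n}(x)-n(n+\alpha)\,t^2\,\widehat{L}^{(\alpha)}_{n-1}(x), $$ where $\widehat{L}^{(\alpha)}_{k}=(-1)^k k!\,L^{(\alpha)}_k$ is the monic Laguerre polynomial of degree $k$ with parameter $\alpha$. Then the product of the extreme zeros (the smallest zero times the largest zero) of $\widehat{L}^{(\alpha)}_{n+1}(\cdot,t)$ is an increasing function of $t$ on the interval $[0,\,0.568774]$.
   Context: For $\alpha>-1$, the Laguerre polynomials $L^{(\alpha)}_k$ ($k=0,1,2,\dots$) are the polynomials of degree $k$, with leading coefficient $(-1)^k/k!$, satisfying $$\int_0^\infty e^{-x}x^\alpha L^{(\alpha)}_m(x)L^{(\alpha)}_k(x)\,\mathrm{d}x=\Gamma(\alpha+1)\binom{k+\alpha}{k}\delta_{mk}.$$ Explicitly, $L_k^{(\alpha)}(x)=\sum_{i=0}^k \binom{k+\alpha}{k-i}\frac{(-x)^i}{i!}$. For real $t$, $\widehat{L}^{(\alpha)}_{n+1}(\cdot,t)$ is a monic real polynomial of degree $n+1$ with only real zeros: it is the characteristic polynomial of the real symmetric tridiagonal matrix with diagonal entries $2j+\alpha-1$ ($j=1,\dots,n+1$) and off-diagonal entries $\sqrt{j(j+\alpha)}$ ($j=1,\dots,n-1$), followed by $t\sqrt{n(n+\alpha)}$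 in the last off-diagonal position. Its extreme zeros are its smallest and its largest zero. ''Increasing'' means strictly increasing. *)

(* Defs.v *)
From mathcomp Require Import all_boot all_order all_algebra.
From mathcomp Require Import classical_sets reals.

Set Implicit Arguments.
Unset Strict Implicit.
Unset Printing Implicit Defensive.

Import Order.TTheory GRing.Theory Num.Theory.
Local Open Scope ring_scope.
Local Open Scope classical_set_scope.

Definition gbinom (R : realType) (a : R) (m : nat) : R :=
  (\prod_(j < m) (a - j%:R)) / m`!%:R.

Definition laguerre (R : realType) (alpha : R) (k : nat) : {poly R} :=
  \sum_(i < k.+1) (gbinom (k%:R + alpha) (k - i) / i`!%:R) *: (- 'X) ^+ i.

Definition monic_laguerre (R : realType) (alpha : R) (k : nat) : {poly R} :=
  ((-1) ^+ k * k`!%:R) *: laguerre alpha k.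

(* The index is shifted: this is the polynomial of degree n.+1, and it is
   meant for 0 < n only. *)
Definition perturbed_laguerre (R : realType) (alpha : R) (n : nat) (t : R) :
    {poly R} :=
  ('X - (2 * n%:R + alpha + 1)%:P) * monic_laguerre alpha n
  - (n%:R * (n%:R + alpha) * t ^+ 2) *: monic_laguerre alpha n.-1.

(* Both take the junk value 0 when p = 0 or p has no root in R. *)
Definition smallest_zero (R : realType) (p : {poly R}) : R :=
  xget 0 [set x : R | root p x /\ forall y : R, root p y -> x <= y].

Definition largest_zero (R : realType) (p : {poly R}) : R :=
  xget 0 [set x : R | root p x /\ forall y : R, root p y -> y <= x].

(* Main.v *)
(* Write b = 2n + alpha + 1, c = n (n + alpha), P_k for the monic Laguerre
   polynomials and s = t^2. The zeros x of the perturbed polynomial are the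
   solutions of S(x) = s, where S(x) = (x - b) P_n(x) / (c P_{n-1}(x)), and the
   derivative formulas for Laguerre polynomials give
     x (x - b) S'(x) = (1 - S) (x - b)^2 + S b + c S^2.
   Let b + w and b - z be the extreme zeros. The logarithmic derivative of their
   product with respect to s is positive iff
     (z - w) ((1 - s) w z - (s b + c s^2)) > 0.
   Centred at b, the Jacobi matrix has nonpositive diagonal, whence z > w;
   truncating the three-term recurrence after two or three steps from the end
   bounds w z from below, which makes the second factor positive for s <= 12/37.
   Rather than differentiating the zeros, the proof fixes the product p of the
   extreme zeros at some s and follows S(x) - S(p / x): it vanishes at the
   largest zero and has negative derivative wherever it vanishes, so it is
   negative at the largest zero for any larger s. *)
Require Import Defs.
From mathcomp Require Import all_boot all_order all_algebra.
From mathcomp Require Import boolp classical_sets functions reals.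
From mathcomp Require Import topology normedtype derive realfun.
From mathcomp Require Import polyrcf.
From mathcomp Require Import ring lra.

Set Implicit Arguments.
Unset Strict Implicit.
Unset Printing Implicit Defensive.

Import Order.TTheory GRing.Theory Num.Theory.
Import numFieldNormedType.Exports.
Local Open Scope ring_scope.

(** * Coefficients, derivative formulas and recurrence of the monic Laguerre polynomials *)

Lemma coef_monic_laguerre (R : realType) (alpha : R) (k i : nat) :
  (monic_laguerre alpha k)`_i =
  (-1) ^+ (k - i) * 'C(k, i)%:R * \prod_(j < k - i) (k%:R + alpha - j%:R).
Proof.
rewrite coefZ coef_sum.
have coefNXn (j : nat) : ((- 'X : {poly R}) ^+ j)`_i = (-1) ^+ j *+ (i == j).
  by rewrite -scaleN1r exprZn coefZ coefXn mulr_natr.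
have [leik|ltki] := leqP i k; last first.
  rewrite bin_small // mulr0 mul0r big1 ?mulr0 // => j _.
  by rewrite coefZ coefNXn (gtn_eqF (leq_trans (ltn_ord j) ltki)) mulr0.
have ltik : (i < k.+1)%N by [].
rewrite (bigD1 (Ordinal ltik)) //= big1 ?addr0 => [|j neq_ji]; last first.
  rewrite coefZ coefNXn; case: eqP => [eq_ij|]; last by rewrite mulr0.
  by case/eqP: neq_ji; apply: val_inj.
rewrite coefZ coefNXn eqxx /gbinom.
have fact_neq0 m : m`!%:R != 0 :> R by rewrite pnatr_eq0 -lt0n fact_gt0.
rewrite -[in (-1) ^+ k](subnK leik) exprD -(bin_fact leik) !natrM.
have := fact_neq0 i; have := fact_neq0 (k - i)%N.
(* The sign [(-1) ^+ (k - i)] is (-1)^k (-1)^i, because the square of (-1)^i is 1. *)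
have sgn : (-1) ^+ i * (-1) ^+ i = 1 :> R by rewrite -expr2 sqrr_sign.
move: ((-1) ^+ i) sgn => e ee Hk Hi.
rewrite mulr1n -[RHS]mulr1 -[X in _ = _ * X]ee; field.
by rewrite Hi Hk.
Qed.

Lemma prod_falling_recl (R : realType) (a : R) (k m : nat) :
  \prod_(j < m.+1) (k.+1%:R + a - j%:R) =
  (k.+1%:R + a) * \prod_(j < m) (k%:R + a - j%:R).
Proof.
rewrite big_ord_recl /= subr0; congr (_ * _).
by apply: eq_bigr => j _; rewrite /bump /= -!natr1; ring.
Qed.

(** Comparing coefficients of x^i reduces this to (k + 1 - i) C(k + 1, i) = (k + 1) C(k, i). *)
Lemma monic_laguerre_deriv (R : realType) (alpha : R) (k : nat) :
  'X * (monic_laguerre alpha k.+1)^`() =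
  k.+1%:R *: monic_laguerre alpha k.+1
  + (k.+1%:R * (k.+1%:R + alpha)) *: monic_laguerre alpha k.
Proof.
apply/polyP => i; rewrite coefXM coefD !(coef_monic_laguerre, coefZ).
have -> : (if i == 0 then 0 else (monic_laguerre alpha k.+1)^`()`_i.-1) =
    i%:R * (monic_laguerre alpha k.+1)`_i.
  by case: i => [|i]; rewrite ?mul0r //= coef_deriv mulr_natl.
rewrite coef_monic_laguerre.
have [leik|] := leqP i k; last first.
  rewrite leq_eqVlt => /orP[/eqP<-|ltki]; first by rewrite (bin_small (ltnSn k)); ring.
  by rewrite (bin_small ltki) (bin_small (ltnW ltki)); ring.
have := mul_bin_down k.+1 i; rewrite subSn // => /(congr1 (fun m => m%:R : R)).
rewrite !natrM; set m := (k - i)%N.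
have ek : k%:R = m%:R + i%:R :> R by rewrite -natrD subnK.
rewrite prod_falling_recl exprS.
rewrite -!natr1 ek; move: ('C(k, i)%:R : R) ('C(k.+1, i)%:R : R) => p q epq.
move: (\prod_(_ < _) _) ((-1) ^+ m) => Q e.
apply/eqP; rewrite -subr_eq0; apply/eqP.
transitivity (e * Q * (m%:R + i%:R + 1 + alpha) *
  ((m%:R + 1) * q - (m%:R + i%:R + 1) * p)); first by ring.
by rewrite epq subrr mulr0.
Qed.

(** After Pascal's rule, the coefficient of x^(i+1) reduces to (i + 1) C(k, i + 1) = (k - i) C(k,
    i). *)
Lemma monic_laguerre_deriv_lower (R : realType) (alpha : R) (k : nat) :
  'X * (monic_laguerre alpha k)^`() =
  'X * monic_laguerre alpha k - (k.+1%:R + alpha) *: monic_laguerre alpha k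
  - monic_laguerre alpha k.+1.
Proof.
apply/polyP => i; rewrite !coefB !coefXM !(coef_monic_laguerre, coefZ).
case: i => [|i] /=.
  by rewrite !subn0 !bin0 prod_falling_recl exprS; ring.
rewrite coef_deriv !coef_monic_laguerre subSS.
have [ltik|] := leqP i.+1 k; last first.
  rewrite leq_eqVlt => /orP[/eqP[<-]|ltki].
    by rewrite !binn (bin_small (ltnSn k)) subnn !big_ord0 /=; ring.
  by rewrite !(bin_small ltki) (bin_small (ltnW ltki)) bin_small //; ring.
rewrite binS natrD.
have /(congr1 (fun m => m%:R : R)) := mul_bin_left k i.
have -> : (k - i)%N = (k - i.+1).+1 by rewrite -subSn.
rewrite !natrM; set m := (k - i.+1)%N.
have ek : k%:R = m%:R + i.+1%:R :> R by rewrite -natrD subnK.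
rewrite prod_falling_recl big_ord_recr /= exprS.
rewrite -mulr_natr; move: (\prod_(_ < _) _) ((-1) ^+ m) => Q e.
rewrite -!natr1 ek -!natr1; move: ('C(k, i)%:R : R) ('C(k, i.+1)%:R : R) => p q epq.
apply/eqP; rewrite -subr_eq0; apply/eqP.
transitivity (e * Q * ((i%:R + 1) * q - (m%:R + 1) * p)); first by ring.
by move: epq; rewrite mul1r => ->; rewrite subrr mulr0.
Qed.

Lemma monic_laguerre0 (R : realType) (alpha : R) : monic_laguerre alpha 0 = 1.
Proof.
apply/polyP => i; rewrite coef_monic_laguerre sub0n big_ord0 coef1 bin0n.
by rewrite expr0 mul1r mulr1.
Qed.

Lemma monic_laguerre1 (R : realType) (alpha : R) :
  monic_laguerre alpha 1 = 'X - (alpha + 1)%:P.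
Proof.
have := monic_laguerre_deriv_lower alpha 0; rewrite monic_laguerre0.
rewrite -polyC1 derivC mulr0 polyC1 mulr1 -[_ *: 1]mul_polyC mulr1 => /esym/eqP.
by rewrite subr_eq0 => /eqP<-; rewrite [alpha + 1]addrC.
Qed.

(** The derivative of P_{k+1} is eliminated between the two derivative formulas. *)
Lemma monic_laguerre_rec (R : realType) (alpha : R) (k : nat) :
  monic_laguerre alpha k.+2 =
  ('X - (2 * k.+1%:R + alpha + 1)%:P) * monic_laguerre alpha k.+1
  - (k.+1%:R * (k.+1%:R + alpha)) *: monic_laguerre alpha k.
Proof.
have := monic_laguerre_deriv_lower alpha k.+1; rewrite monic_laguerre_deriv.
move=> /(congr1 (fun p => 'X * monic_laguerre alpha k.+1
  - (k.+2%:R + alpha) *: monic_laguerre alpha k.+1 - p)).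
rewrite opprB [RHS]addrC subrK => <-.
rewrite -!mul_polyC -![k.+2%:R]natr1 !(polyCD, polyCM, polyCN, polyC1).
by ring.
Qed.

(** * Three-term recurrences: positivity and comparison at a point *)

(** For g >= 0 these are the characteristic polynomials of the leading blocks of a Jacobi matrix
    with diagonal entries [- d k] and squared off-diagonal entries [g k.+1]. *)
Definition three_term (R : realType) (d g : nat -> R) (p : nat -> {poly R}) :=
  [/\ p 0 = 1, p 1 = 'X + (d 0)%:P &
      forall k, p k.+2 = ('X + (d k.+1)%:P) * p k.+1 - g k.+1 *: p k].

Lemma three_term_horner (R : realType) (d g : nat -> R) (p : nat -> {poly R}) :
  three_term d g p -> forall y : R,
  [/\ (p 0).[y] = 1, (p 1).[y] = y + d 0%N &
      forall k, (p k.+2).[y] = (y + d k.+1) * (p k.+1).[y] - g k.+1 * (p k).[y]].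
Proof.
by move=> [-> -> prec] y; split=> [||k]; rewrite ?prec !hornerE.
Qed.

(** If p_{k+1} vanished at y while p_k(y) > 0, the recurrence would make p_{k+2}(y) negative. *)
Lemma three_term_gt0 (R : realType) (d g : nat -> R) (p : nat -> {poly R})
    (n : nat) (y : R) :
  three_term d g p -> (forall k, 0 < g k.+1) ->
  (forall k, (k <= n)%N -> 0 <= (p k).[y]) ->
  forall k, (k < n)%N -> 0 < (p k).[y].
Proof.
move=> /three_term_horner/(_ y)[p0 p1 prec] g_gt0 p_ge0.
elim=> [|k IHk] ltkn; first by rewrite p0.
rewrite lt_def p_ge0 1?ltnW // andbT; apply/eqP => pk1.
have := p_ge0 _ ltkn; rewrite prec pk1 mulr0 sub0r oppr_ge0 leNgt.
by rewrite mulr_gt0 // IHk // ltnW.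
Qed.

(** The ratios r_k = p_{k+1}(y) / p_k(y) satisfy r_{k+1} = y + d_{k+1} - g_{k+1} / r_k, which
    increases with y + d_{k+1} and with r_k, so a strict inequality at k = 0 propagates. The
    conclusion is r_k < r'_k, cross-multiplied. *)
Lemma three_term_lt (R : realType) (d d' g : nat -> R)
    (p p' : nat -> {poly R}) (n : nat) (y y' : R) :
  three_term d g p -> three_term d' g p' -> (forall k, 0 < g k.+1) ->
  (forall k, (k <= n)%N -> 0 <= (p k).[y]) ->
  y + d 0%N < y' + d' 0%N ->
  (forall k, (k < n)%N -> y + d k <= y' + d' k) ->
  forall k, (k < n)%N ->
    0 < (p' k).[y'] /\ (p k.+1).[y] * (p' k).[y'] < (p' k.+1).[y'] * (p k).[y].
Proof.
move=> tp tp' g_gt0 p_ge0 lt0 led.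
have p_gt0 := three_term_gt0 tp g_gt0 p_ge0.
have [p0 p1 prec] := three_term_horner tp y.
have [p'0 p'1 prec'] := three_term_horner tp' y'.
elim=> [|k IHk] ltkn; first by rewrite p'0 p0 p1 p'1 !mulr1.
have [p'k_gt0 ltk] := IHk (ltnW ltkn).
have p'k1_gt0 : 0 < (p' k.+1).[y'].
  rewrite -(pmulr_lgt0 _ (p_gt0 _ (ltnW ltkn))).
  by rewrite (le_lt_trans _ ltk) // mulr_ge0 // ltW // p_gt0.
split=> //; rewrite prec prec' -subr_gt0.
have -> : ((y' + d' k.+1) * (p' k.+1).[y'] - g k.+1 * (p' k).[y']) * (p k.+1).[y]
  - ((y + d k.+1) * (p k.+1).[y] - g k.+1 * (p k).[y]) * (p' k.+1).[y'] =
  g k.+1 * ((p' k.+1).[y'] * (p k).[y] - (p k.+1).[y] * (p' k).[y'])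
  + (y' + d' k.+1 - (y + d k.+1)) * ((p' k.+1).[y'] * (p k.+1).[y]).
  by ring.
rewrite ltr_pwDl ?mulr_gt0 ?subr_gt0 // mulr_ge0 ?subr_ge0 ?led //.
by rewrite ltW // mulr_gt0 // p_gt0.
Qed.

(** * Existence of a largest zero, and positivity of the lower-degree polynomials there *)

Definition pos_from (R : realType) (p : {poly R}) (x : R) :=
  forall y, x <= y -> 0 < p.[y].

Lemma pos_from_noroot (R : realType) (p : {poly R}) (x : R) :
  0 < lead_coef p -> (forall y, x <= y -> ~~ root p y) -> pos_from p x.
Proof.
move=> lp nr y lexy; have := @sgp_pinftyP _ x p.
rewrite /sgp_pinfty (gtr0_sg lp) => H.
rewrite -sgr_gt0 H ?ltr01 // ?in_itv /= ?lexy // => z.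
by rewrite in_itv /= andbT => /nr.
Qed.

Lemma horner_ge0_right (R : realType) (p : {poly R}) (x : R) :
  (forall y, x < y -> 0 < p.[y]) -> 0 <= p.[x].
Proof.
move=> p_gt0; rewrite leNgt; apply/negP => px_lt0.
have ltx1 : x < x + 1 by rewrite ltrDl.
have [|z] := @poly_ivtoo _ p x (x + 1) (ltW ltx1); first by rewrite nmulr_rlt0 ?p_gt0.
by rewrite in_itv /= => /andP[/p_gt0 pz _] /eqP pz0; rewrite pz0 ltxx in pz.
Qed.

Lemma poly_max_root (R : realType) (p : {poly R}) (x : R) :
  p != 0 -> root p x ->
  exists2 y, root p y & forall z, root p z -> z <= y.
Proof.
move=> p_neq0 rpx; have rE z : (z \in rootsR p) = root p z.
  by rewrite -(roots_on_rootsR p_neq0).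
have max_seq (s : seq R) (a : R) : exists2 y, y \in a :: s &
    forall z, z \in a :: s -> z <= y.
  elim: s a => [|b s IHs] a; first by exists a => [|z]; rewrite inE // => /eqP ->.
  have [y ys ymax] := IHs b; exists (Num.max a y).
    by case: leP => _; rewrite !inE ?eqxx // in ys *; rewrite ys orbT.
  move=> z; rewrite inE le_max => /orP[/eqP-> | /ymax ->]; by rewrite ?lexx ?orbT.
move: rpx; rewrite -rE => xs.
have: exists2 y, y \in rootsR p & forall z, z \in rootsR p -> z <= y.
  by case: (rootsR p) xs => // a s _; apply: max_seq.
by case=> y; rewrite rE => ry ymax; exists y => // z; rewrite -rE; apply: ymax.
Qed.

(** Otherwise let z be the largest zero of q. To its right q is positive, hence so is p, so p(z) >=
    0 and r(z) = - g p(z) <= 0, although z lies in the range where r > 0. *)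
Lemma pos_from_step (R : realType) (d g : R) (p q r : {poly R}) :
  r = ('X + d%:P) * q - g *: p -> 0 <= g -> 0 < lead_coef q ->
  (forall x, pos_from q x -> pos_from p x) ->
  forall x, pos_from r x -> pos_from q x.
Proof.
move=> -> g_ge0 lq qp x r_gt0; apply: pos_from_noroot => // y lexy.
have q_neq0 : q != 0 by rewrite -lead_coef_eq0 gt_eqF.
apply/negP => ry; have [z rz zmax] := poly_max_root q_neq0 ry.
have pz_ge0 : 0 <= p.[z].
  apply: horner_ge0_right => u ltzu; apply: (qp u) => //.
  apply: pos_from_noroot => // v leuv; apply/negP => /zmax.
  by rewrite leNgt (lt_le_trans ltzu leuv).
have := r_gt0 z (le_trans lexy (zmax _ ry)).
by rewrite !hornerE (eqP rz) mulr0 sub0r oppr_gt0 ltNge mulr_ge0.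
Qed.

Lemma size_lead_coef_step (R : realType) (d g : R) (p q : {poly R}) :
  q != 0 -> (size p <= size q)%N ->
  let r := ('X + d%:P) * q - g *: p in
  size r = (size q).+1 /\ lead_coef r = lead_coef q.
Proof.
move=> q_neq0 spq r.
have sM : size (('X + d%:P) * q) = (size q).+1.
  by rewrite size_monicM ?monicXaddC // size_XaddC.
have ltS : (size (- (g *: p)) < size (('X + d%:P) * q)%R)%N.
  by rewrite size_polyN sM ltnS (leq_trans (size_scale_leq _ _)).
rewrite /r size_polyDl // lead_coefDl // sM lead_coefM.
by rewrite (eqP (monicXaddC _)) mul1r.
Qed.

Lemma size_lead_coef_three_term (R : realType) (d g : nat -> R)
    (p : nat -> {poly R}) :
  three_term d g p -> forall k, size (p k) = k.+1 /\ lead_coef (p k) = 1.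
Proof.
move=> [p0 p1 prec] k.
suff: (size (p k) = k.+1 /\ lead_coef (p k) = 1) /\
  (size (p k.+1) = k.+2 /\ lead_coef (p k.+1) = 1) by case.
elim: k => [|k [[sk lk] [sk1 lk1]]].
  by rewrite p0 p1 lead_coef1 size_poly1 size_XaddC (eqP (monicXaddC _)).
split=> //; rewrite prec -lk1 -sk1; apply: size_lead_coef_step.
  by rewrite -size_poly_eq0 sk1.
by rewrite sk sk1.
Qed.

(* The last coefficient of the recurrence is free, and may vanish. *)
Lemma three_term_extreme (R : realType) (d g : nat -> R)
    (p : nat -> {poly R}) (n : nat) (h c : R) :
  three_term d g p -> (forall k, 0 <= g k.+1) -> 0 <= c ->
  let q := ('X + h%:P) * p n.+1 - c *: p n in
  exists y, [/\ root q y, forall z, root q z -> z <= y &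
    forall k, (k <= n.+1)%N -> 0 <= (p k).[y]].
Proof.
move=> tp g_ge0 c_ge0 q; have slp := size_lead_coef_three_term tp.
have lp k : lead_coef (p k) = 1 by have [] := slp k.
have down k x : pos_from (p k.+1) x -> pos_from (p k) x.
  have [p0 p1 prec] := tp; elim: k x => [|k IHk] x.
    by move=> _ y _; rewrite p0 hornerC.
  by apply: (pos_from_step (prec k)) => //; rewrite lp.
have downq x : pos_from q x -> pos_from (p n.+1) x.
  by apply: (pos_from_step (erefl q)) (down n) _ => //; rewrite lp.
have downp k x : (k <= n.+1)%N -> pos_from (p n.+1) x -> pos_from (p k) x.
  by move=> /subnK <-; elim: (_ - k)%N => [|m IHm] // /down/IHm.
have [sn ln] := slp n; have [sn1 ln1] := slp n.+1.
have pn1_neq0 : p n.+1 != 0 by rewrite -size_poly_eq0 sn1.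
have lq : 0 < lead_coef q.
  by have [|_ ->] := @size_lead_coef_step _ h c (p n) _ pn1_neq0; rewrite ?sn ?sn1 ?ln1.
have q_neq0 : q != 0 by rewrite -lead_coef_eq0 gt_eqF.
(* Without a real zero q would be positive everywhere, and descending to degree one would make p_1
   positive at its own zero [- d 0]. *)
have [x rx] : exists x, root q x.
  apply: contrapT => nr; have [_ p1 _] := tp.
  have q_gt0 : pos_from q (- d 0%N).
    by apply: pos_from_noroot => // y _; apply/negP => ry; apply: nr; exists y.
  have := downp 1%N _ isT (downq _ q_gt0) _ (lexx _).
  by rewrite p1 !hornerE addNr ltxx.
have [y ry ymax] := poly_max_root q_neq0 rx.
exists y; split=> // k lekn; apply: horner_ge0_right => z ltyz.
apply: (downp k z) => //; apply: downq; apply: pos_from_noroot => // u lezu.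
by apply/negP => /ymax; rewrite leNgt (lt_le_trans ltyz lezu).
Qed.

(** * Polynomials centred at the last diagonal entry, and monotonicity of the level *)

Definition centre (R : realType) (alpha : R) (n : nat) : R :=
  2 * n%:R + alpha + 1.

(* For e = 1 (resp. e = -1) the variable is the distance to the right (resp.
   left) of the last diagonal entry [centre alpha n], so that both extreme
   zeros are treated as largest zeros. *)
Definition centred_laguerre (R : realType) (alpha : R) (n : nat) (e : R)
    (k : nat) : {poly R} :=
  e ^+ k *: (monic_laguerre alpha k \Po ((centre alpha n)%:P + e *: 'X)).

Lemma horner_centred_laguerre (R : realType) (alpha e : R) (n k : nat) (y : R) :
  (centred_laguerre alpha n e k).[y] =
  e ^+ k * (monic_laguerre alpha k).[centre alpha n + e * y].
Proof. by rewrite hornerZ horner_comp !hornerE. Qed.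

(** Since [e ^+ 2 = 1], the choice of side changes only the sign of the diagonal and leaves the
    off-diagonal coefficients alone; this makes the two sides comparable. *)
Lemma centred_laguerre_three_term (R : realType) (alpha e : R) (n : nat) :
  e ^+ 2 = 1 ->
  three_term (fun k => 2 * e * (n%:R - k%:R)) (fun k => k%:R * (k%:R + alpha))
    (centred_laguerre alpha n e).
Proof.
move=> e2; split=> [||k].
- by rewrite /centred_laguerre monic_laguerre0 -polyC1 comp_polyC scale1r.
- rewrite /centred_laguerre monic_laguerre1 comp_polyB comp_polyX comp_polyC.
  rewrite expr1 /centre -addrA addrCA scalerDr scalerA -expr2 e2 scale1r.
  by congr (_ + _); rewrite -polyCB -mul_polyC -polyCM; congr _%:P; ring.
- rewrite /centred_laguerre monic_laguerre_rec.
  move: (monic_laguerre alpha k.+1) (monic_laguerre alpha k) => p q.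
  rewrite comp_polyB comp_polyM comp_polyZ comp_polyB comp_polyX comp_polyC.
  have -> : (centre alpha n)%:P + e *: 'X - (2 * k.+1%:R + alpha + 1)%:P =
      e *: ('X + (2 * e * (n%:R - k.+1%:R))%:P).
    rewrite addrAC addrC -polyCB scalerDr -[e *: _%:P]mul_polyC -polyCM.
    congr (_ + _%:P); transitivity (e ^+ 2 * (2 * (n%:R - k.+1%:R))); last by ring.
    by rewrite e2 /centre; ring.
  rewrite scalerBr -scalerAl -scalerAr !scalerA.
  have -> : e ^+ k.+2 * e = e ^+ k.+1.
    by rewrite -exprSr -addn2 exprD e2 mulr1.
  by congr (_ - _ *: _); rewrite -addn2 exprD e2 mulr1 mulrC.
Qed.

Lemma root_perturbed_laguerre (R : realType) (alpha e t : R) (n : nat) (y : R) :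
  e ^+ 2 = 1 ->
  let p := centred_laguerre alpha n.+1 e in
  root (perturbed_laguerre alpha n.+1 t) (centre alpha n.+1 + e * y) =
  root (('X + 0%:P) * p n.+1
        - (n.+1%:R * (n.+1%:R + alpha) * t ^+ 2) *: p n) y.
Proof.
move=> e2 p; have e_neq0 : e != 0 by rewrite -sqrf_eq0 e2 oner_neq0.
rewrite !rootE -(mulrI_eq0 _ (mulfI (expf_neq0 n.+2 e_neq0))); congr (_ == 0).
set c := _ * t ^+ 2.
rewrite /perturbed_laguerre -/c !(hornerD, hornerM, hornerN, hornerX, hornerC) !(hornerZ c).
rewrite /p !horner_centred_laguerre /= -/(centre alpha n.+1).
move: (monic_laguerre _ n.+1).[_] (monic_laguerre _ n).[_] => u v.
rewrite !exprS; have ee : e * e = 1 by rewrite -expr2.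
move: (e ^+ n) => f.
transitivity (e * e * (e * f * y * u - c * f * v)).
  by rewrite /centre; ring.
by rewrite ee; ring.
Qed.

(* [y] lies weakly beyond every zero of P_0, ..., P_n on the side [e]. *)
Definition outer (R : realType) (alpha : R) (n : nat) (e y : R) :=
  forall k, (k <= n)%N -> 0 <= (centred_laguerre alpha n e k).[y].

Lemma laguerre_coef_gt0 (R : realType) (alpha : R) :
  -1 < alpha -> forall k, 0 < k.+1%:R * (k.+1%:R + alpha) :> R.
Proof.
move=> alpha_gt k; have k_ge0 : 0 <= k%:R :> R by rewrite ler0n.
by rewrite mulr_gt0 // -natr1; lra.
Qed.

Lemma outer_gt0 (R : realType) (alpha e y : R) (n k : nat) :
  -1 < alpha -> e ^+ 2 = 1 -> outer alpha n e y -> (k < n)%N ->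
  0 < (centred_laguerre alpha n e k).[y].
Proof.
move=> alpha_gt e2 yout; apply: three_term_gt0 yout _.
- exact: (centred_laguerre_three_term alpha n e2).
- exact: laguerre_coef_gt0.
Qed.

Lemma extreme_zero_exists (R : realType) (alpha e t : R) (n : nat) :
  -1 < alpha -> e ^+ 2 = 1 ->
  exists y, [/\ root (perturbed_laguerre alpha n.+1 t) (centre alpha n.+1 + e * y),
    forall z, root (perturbed_laguerre alpha n.+1 t) (centre alpha n.+1 + e * z) ->
      z <= y &
    outer alpha n.+1 e y].
Proof.
move=> alpha_gt e2; have g_gt0 := laguerre_coef_gt0 alpha_gt.
have [k||y [ry ymax yout]] := @three_term_extreme _ _ _ _ n 0
    (n.+1%:R * (n.+1%:R + alpha) * t ^+ 2)
    (centred_laguerre_three_term alpha n.+1 e2).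
- exact: ltW.
- by rewrite mulr_ge0 ?sqr_ge0 // ltW.
exists y; split=> [|z|//]; rewrite root_perturbed_laguerre //; exact: ymax.
Qed.

(* [x] is a zero of [perturbed_laguerre alpha n t] iff
   [level alpha n x = t ^+ 2]. *)
Definition level (R : realType) (alpha : R) (n : nat) (x : R) : R :=
  (x - centre alpha n) * (monic_laguerre alpha n).[x]
  / (n%:R * (n%:R + alpha) * (monic_laguerre alpha n.-1).[x]).

Lemma level_centred (R : realType) (alpha e y : R) (n : nat) :
  e ^+ 2 = 1 ->
  level alpha n.+1 (centre alpha n.+1 + e * y) =
  y * (centred_laguerre alpha n.+1 e n.+1).[y]
  / (n.+1%:R * (n.+1%:R + alpha) * (centred_laguerre alpha n.+1 e n).[y]).
Proof.
move=> e2; have e_neq0 : e != 0 by rewrite -sqrf_eq0 e2 oner_neq0.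
rewrite /level !horner_centred_laguerre /= exprS addrAC subrr add0r.
have ff : (e ^+ n)^-1 * e ^+ n = 1 by rewrite mulVf ?expf_neq0.
rewrite !invfM; set P := (monic_laguerre _ n.+1).[_].
set Q := (monic_laguerre _ n).[_]^-1; set c := n.+1%:R^-1.
set c' := (_ + alpha)^-1.
transitivity ((e ^+ n)^-1 * e ^+ n * (e * y * P * (c * c' * Q))).
  by rewrite ff mul1r.
by ring.
Qed.

Lemma level_root (R : realType) (alpha e y t : R) (n : nat) :
  -1 < alpha -> e ^+ 2 = 1 -> outer alpha n.+1 e y ->
  root (perturbed_laguerre alpha n.+1 t) (centre alpha n.+1 + e * y) ->
  level alpha n.+1 (centre alpha n.+1 + e * y) = t ^+ 2.
Proof.
move=> alpha_gt e2 yout; rewrite root_perturbed_laguerre // level_centred //.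
have := outer_gt0 alpha_gt e2 yout (ltnSn n).
have := laguerre_coef_gt0 alpha_gt n.
rewrite rootE !(hornerD, hornerM, hornerN, hornerX, hornerC).
rewrite (hornerZ (_ * t ^+ 2)) addr0.
move: (centred_laguerre _ _ _ n.+1).[y] (centred_laguerre _ _ _ n).[y] => u v.
move: (n.+1%:R * _) => c c_gt0 v_gt0; rewrite subr_eq0 => /eqP->.
by field; rewrite !gt_eqF.
Qed.

(** By [level_centred] the level is y times the ratio of the last two polynomials, up to a positive
    constant. The ratio grows strictly by [three_term_lt]. Taking e < e' compares the left side with
    the right one. *)
Lemma outer_level_lt (R : realType) (alpha e e' y y' : R) (n : nat) :
  -1 < alpha -> e ^+ 2 = 1 -> e' ^+ 2 = 1 -> outer alpha n.+1 e y ->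
  e <= e' -> y <= y' -> e + y < e' + y' -> 0 < y' ->
  outer alpha n.+1 e' y' /\
  level alpha n.+1 (centre alpha n.+1 + e * y) <
  level alpha n.+1 (centre alpha n.+1 + e' * y').
Proof.
move=> alpha_gt e2 e'2 yout le_e le_y lt_ey y'_gt0.
have g_gt0 := laguerre_coef_gt0 alpha_gt.
have cmp := @three_term_lt _ _ _ _ _ _ n.+1 y y'
  (centred_laguerre_three_term alpha n.+1 e2)
  (centred_laguerre_three_term alpha n.+1 e'2) g_gt0 yout.
have {}cmp k : (k < n.+1)%N ->
    0 < (centred_laguerre alpha n.+1 e' k).[y'] /\
    (centred_laguerre alpha n.+1 e k.+1).[y]
      * (centred_laguerre alpha n.+1 e' k).[y'] <
    (centred_laguerre alpha n.+1 e' k.+1).[y']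
      * (centred_laguerre alpha n.+1 e k).[y].
  apply: cmp => [|j ltjn].
    have n_ge0 : 0 <= n%:R :> R by rewrite ler0n.
    by rewrite -natr1; nra.
  have : j%:R <= n.+1%:R :> R by rewrite ler_nat ltnW.
  by nra.
have [v'_gt0 ltuv] := cmp n (ltnSn n).
have v_gt0 := outer_gt0 alpha_gt e2 yout (ltnSn n).
have u_ge0 := yout _ (leqnn n.+1).
split.
  move=> k; rewrite leq_eqVlt => /orP[/eqP->|/cmp[/ltW //]].
  rewrite ltW // -(pmulr_lgt0 _ v_gt0) (le_lt_trans _ ltuv) //.
  by rewrite mulr_ge0 // ltW.
rewrite !level_centred //; have := g_gt0 n; move: (n.+1%:R * _) => c c_gt0.
rewrite ltr_pdivrMr ?mulr_gt0 // mulrAC ltr_pdivlMr ?mulr_gt0 //.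
move: ltuv u_ge0 v_gt0 v'_gt0.
move: (centred_laguerre _ _ e n.+1).[y] (centred_laguerre _ _ e n).[y].
move: (centred_laguerre _ _ e' n.+1).[y'] (centred_laguerre _ _ e' n).[y'].
move=> u' v' u v ltuv u_ge0 v_gt0 v'_gt0.
have -> : y * u * (c * v') = c * (y * (u * v')) by ring.
have -> : y' * u' * (c * v) = c * (y' * (u' * v)) by ring.
rewrite ltr_pM2l //; apply: (@le_lt_trans _ _ (y' * (u * v'))).
  by rewrite ler_wpM2r // mulr_ge0 // ltW.
by rewrite ltr_pM2l.
Qed.

(** * Bounds on the extreme zeros: their distances from the centre, and positivity *)

(** The recurrence is run two steps down from the end, and the last subtracted term, a positive
    multiple of p_n, is dropped. *)
Lemma outer_trunc2 (R : realType) (alpha e y : R) (n : nat) :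
  -1 < alpha -> e ^+ 2 = 1 -> outer alpha n.+3 e y ->
  0 < y + 2 * e /\
  n.+2%:R * (n.+2%:R + alpha) <= (y + 2 * e) * (y + 4 * e).
Proof.
move=> alpha_gt e2 yout.
have [_ _ prec] := three_term_horner (centred_laguerre_three_term alpha n.+3 e2) y.
have pos k := outer_gt0 alpha_gt e2 yout (k := k).
have := yout _ (leqnn n.+3); rewrite prec.
have := prec n; have := pos n.+2 (ltnSn _).
have := pos n.+1 (leqnSn n.+2); have := pos n (leq_trans (leqnSn n.+1) (leqnSn _)).
have := laguerre_coef_gt0 alpha_gt n; have := laguerre_coef_gt0 alpha_gt n.+1.
have -> : 2 * e * (n.+3%:R - n.+2%:R) = 2 * e by rewrite -!natr1; ring.
have -> : 2 * e * (n.+3%:R - n.+1%:R) = 4 * e by rewrite -!natr1; ring.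
move: (n.+2%:R * _) (n.+1%:R * _) => c c'.
move: (centred_laguerre _ _ _ n.+2).[y] (centred_laguerre _ _ _ n.+1).[y].
move: (centred_laguerre _ _ _ n).[y] => t v u c_gt0 c'_gt0 t_gt0 v_gt0 u_gt0 eu.
rewrite subr_ge0 => le_cv.
have y2_gt0 : 0 < y + 2 * e.
  by rewrite -(pmulr_lgt0 _ u_gt0) (lt_le_trans _ le_cv) // mulr_gt0.
split=> //; rewrite -(ler_pM2r v_gt0) (le_trans le_cv) // eu -mulrA.
by rewrite ler_wpM2l ?(ltW y2_gt0) // gerBl mulr_ge0 // ltW.
Qed.

(** One more step is kept: p_{n+2} <= (y + 6 e) p_{n+1} bounds from below the term that
    [outer_trunc2] drops. *)
Lemma outer_trunc3 (R : realType) (alpha e y : R) (n : nat) :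
  -1 < alpha -> e ^+ 2 = 1 -> outer alpha n.+4 e y ->
  n.+3%:R * (n.+3%:R + alpha) * (y + 6 * e) <=
  (y + 2 * e) * ((y + 4 * e) * (y + 6 * e) - n.+2%:R * (n.+2%:R + alpha)).
Proof.
move=> alpha_gt e2 yout; have [y2_gt0 _] := outer_trunc2 alpha_gt e2 yout.
have [_ _ prec] := three_term_horner (centred_laguerre_three_term alpha n.+4 e2) y.
have pos k := outer_gt0 alpha_gt e2 yout (k := k).
have := yout _ (leqnn n.+4); rewrite prec.
have := prec n; have := prec n.+1; have := pos n.+3 (ltnSn _).
have := pos n.+2 (leqnSn _); have := pos n.+1 (leq_trans (leqnSn _) (leqnSn _)).
have := pos n (leq_trans (leqnSn _) (leq_trans (leqnSn _) (leqnSn _))).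
have := laguerre_coef_gt0 alpha_gt n; have := laguerre_coef_gt0 alpha_gt n.+1.
have := laguerre_coef_gt0 alpha_gt n.+2.
have -> : 2 * e * (n.+4%:R - n.+3%:R) = 2 * e by rewrite -!natr1; ring.
have -> : 2 * e * (n.+4%:R - n.+2%:R) = 4 * e by rewrite -!natr1; ring.
have -> : 2 * e * (n.+4%:R - n.+1%:R) = 6 * e by rewrite -!natr1; ring.
move: (n.+3%:R * _) (n.+2%:R * _) (n.+1%:R * _) => c1 c2 c3.
move: (centred_laguerre _ _ _ n.+3).[y] (centred_laguerre _ _ _ n.+2).[y].
move: (centred_laguerre _ _ _ n.+1).[y] (centred_laguerre _ _ _ n).[y].
move=> u1 u0 u3 u2 c1_gt0 c2_gt0 c3_gt0 u0_gt0 u1_gt0 u2_gt0 u3_gt0 e3 e1.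
rewrite subr_ge0 => le_c.
have le_u2 : u2 <= (y + 6 * e) * u1 by rewrite e1 gerBl mulr_ge0 // ltW.
have y6_gt0 : 0 < y + 6 * e.
  by rewrite -(pmulr_lgt0 _ u1_gt0) (lt_le_trans _ le_u2).
rewrite -(ler_pM2r u2_gt0); apply: (@le_trans _ _ ((y + 2 * e) * u3 * (y + 6 * e))).
  by rewrite [_ * u2]mulrAC ler_wpM2r // ltW.
rewrite -!mulrA ler_wpM2l ?(ltW y2_gt0) // e3; nra.
Qed.

Lemma sqrrN1 (R : realType) : (-1) ^+ 2 = 1 :> R.
Proof. by rewrite sqrrN expr1n. Qed.

(** Truncation gives (w + 2)(w + 4) >= (n - 1)(n - 1 + alpha) > 12 for n >= 5, whereas the product
    is at most 8 when -2 < w <= 0. *)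
Lemma outer_right_gt0 (R : realType) (alpha w : R) (n : nat) :
  -1 < alpha -> (5 <= n)%N -> outer alpha n 1 w -> 0 < w.
Proof.
move=> alpha_gt; case: n => [|[|[|n]]] // n_ge5.
have n_ge : 2 <= n%:R :> R by rewrite (ler_nat R 2 n).
move=> /(outer_trunc2 alpha_gt (expr1n R 2))[w2_gt0].
by rewrite -!natr1 => le_w; nra.
Qed.

Lemma outer_left_gt4 (R : realType) (alpha z : R) (n : nat) :
  -1 < alpha -> (5 <= n)%N -> outer alpha n (-1) z -> 4 < z.
Proof.
move=> alpha_gt; case: n => [|[|[|n]]] // n_ge5.
have n_ge : 2 <= n%:R :> R by rewrite (ler_nat R 2 n).
move=> /(outer_trunc2 alpha_gt (sqrrN1 R))[z2_gt0].
by rewrite -!natr1 => le_z; nra.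
Qed.

(** Positivity of the centred polynomial of degree one, whose zero is 2 n. *)
Lemma outer_left_gt (R : realType) (alpha z : R) (n : nat) :
  -1 < alpha -> (1 < n)%N -> outer alpha n (-1) z -> 2 * n%:R < z.
Proof.
move=> alpha_gt n_gt1 zout.
have [_ p1 _] := three_term_horner (centred_laguerre_three_term alpha n (sqrrN1 R)) z.
have := outer_gt0 alpha_gt (sqrrN1 R) zout n_gt1.
by rewrite p1; lra.
Qed.

Lemma outer_mul_ge (R : realType) (alpha w z : R) (n : nat) :
  -1 < alpha -> (4 <= n)%N -> outer alpha n.+1 1 w -> outer alpha n.+1 (-1) z ->
  n%:R * (n%:R + alpha) - 8 <= w * z.
Proof.
move=> alpha_gt n_ge4 wout zout; have w_gt0 := outer_right_gt0 alpha_gt _ wout.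
have z_gt4 := outer_left_gt4 alpha_gt _ zout.
case: n n_ge4 wout zout w_gt0 z_gt4 => [|[|n]] // n_ge4 wout zout /(_ n_ge4) w_gt0 /(_ n_ge4) z_gt4.
have [_] := outer_trunc2 alpha_gt (expr1n R 2) wout.
have [_] := outer_trunc2 alpha_gt (sqrrN1 R) zout.
have := laguerre_coef_gt0 alpha_gt n.+1.
move: (_ * (_ + alpha)) => c c_gt0 le_z le_w.
(* Completing squares in the truncated bounds gives (w + 3)^2 >= c + 1 and (z - 3)^2 >= c + 1,
   whence w z >= (m - 3)(m + 3) = c - 8. *)
pose m := Num.sqrt (c + 1).
have m2 : m ^+ 2 = c + 1 by rewrite sqr_sqrtr //; lra.
have m_ge0 : 0 <= m by rewrite sqrtr_ge0.
have wm : m <= w + 3.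
  by rewrite -(ler_pXn2r (n := 2)) ?nnegrE //; [lra|nra].
have zm : m <= z - 3.
  by rewrite -(ler_pXn2r (n := 2)) ?nnegrE //; [lra|nra].
by nra.
Qed.

(* The condition [s b + c s^2 < (1 - s) w z] at [s = 12 / 37], which is
   slightly above [0.568774 ^ 2]. *)
Lemma outer_mul_gt (R : realType) (alpha w z : R) (n : nat) :
  -1 < alpha -> (5 <= n)%N -> outer alpha n 1 w -> outer alpha n (-1) z ->
  444 * centre alpha n + 144 * (n%:R * (n%:R + alpha)) < 925 * (w * z).
Proof.
move=> alpha_gt n_ge5 wout zout; case: n n_ge5 wout zout => // n n_ge4 wout zout.
have := outer_mul_ge alpha_gt n_ge4 wout zout; rewrite /centre -[n.+1%:R]natr1.
move: n_ge4; rewrite leq_eqVlt => /orP[/eqP[en]|n_ge5]; last first.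
  have n_ge : 5 <= n%:R :> R by rewrite (ler_nat R 5 n).
  by move=> le_wz; nra.
subst n.
(* Now the index [n.+1] is 5, and the bound w z >= 8 + 4 alpha suffices only for alpha above about
   0.43; smaller values need the three-step truncation. *)
have [alpha_ge|alpha_lt] := leP (1 / 2) alpha; first by move=> le_wz; nra.
move=> _; have w_gt0 : 0 < w by apply: (outer_right_gt0 alpha_gt) wout.
have z_gt : 2 * 5 < z by apply: (outer_left_gt alpha_gt) zout.
have := outer_trunc3 alpha_gt (expr1n R 2) wout.
(* As z > 10, it suffices that w >= (8484 + 1164 alpha) / 9250; the threshold is a rounding of this,
   slightly above it for alpha < 1/2. *)
have [w_ge|w_lt] := leP (23 / 25 + alpha / 8) w.
  have : 0 < w * (z - 10) by rewrite mulr_gt0 // subr_gt0; lra.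
  by lra.
have w_lt1 : w < 1 by lra.
(* With w^2 and w^3 bounded through w < 1, the three-step inequality is refuted by linear
   arithmetic. *)
have w2_lt : w * w < w by rewrite gtr_pMr.
have : (w + 2) * (w * w) <= (w + 2) * w by rewrite ler_pM2l ?ltW //; lra.
have : 0 < w * (alpha + 1) by rewrite mulr_gt0 //; lra.
by lra.
Qed.

(** For x <= 0 the reflected polynomials grow from degree k to k + 1 by a factor of at least k + 1 +
    alpha, the exact ratio at x = 0; with t^2 <= 1 the perturbing term is then too small to cancel
    the leading one. *)
Lemma root_perturbed_laguerre_gt0 (R : realType) (alpha t x : R) (n : nat) :
  -1 < alpha -> t ^+ 2 <= 1 -> root (perturbed_laguerre alpha n.+1 t) x -> 0 < x.
Proof.
move=> alpha_gt t2_le1; rewrite ltNge; apply: contraTN => x_le0.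
pose z := centre alpha n.+1 - x.
have -> : x = centre alpha n.+1 + -1 * z by rewrite /z; ring.
have z_ge : centre alpha n.+1 <= z by rewrite /z; lra.
rewrite root_perturbed_laguerre ?sqrrN1 //.
have [p0 p1 prec] :=
  three_term_horner (centred_laguerre_three_term alpha n.+1 (sqrrN1 R)) z.
have grow k : 0 < (centred_laguerre alpha n.+1 (-1) k).[z] /\
    (k.+1%:R + alpha) * (centred_laguerre alpha n.+1 (-1) k).[z] <=
    (centred_laguerre alpha n.+1 (-1) k.+1).[z].
  elim: k => [|k [pk_gt0 le_pk]].
    by rewrite p0 p1; move: z_ge; rewrite /centre => z_ge; lra.
  have k1a_gt0 : 0 < k.+1%:R + alpha.
    by have := laguerre_coef_gt0 alpha_gt k; rewrite pmulr_rgt0 // ltr0n.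
  have pk1_gt0 : 0 < (centred_laguerre alpha n.+1 (-1) k.+1).[z].
    by apply: lt_le_trans le_pk; rewrite mulr_gt0.
  split=> //; rewrite prec.
  (* The subtracted term of the recurrence is at most (k + 1) p_{k+1}, and the diagonal factor is at
     least 2 (k + 1) + alpha + 1; the difference leaves k + 2 + alpha. *)
  have : k.+1%:R * ((k.+1%:R + alpha) * (centred_laguerre alpha n.+1 (-1) k).[z])
      <= k.+1%:R * (centred_laguerre alpha n.+1 (-1) k.+1).[z].
    by rewrite ler_wpM2l.
  have : (2 * k.+1%:R + alpha + 1) * (centred_laguerre alpha n.+1 (-1) k.+1).[z]
      <= (z + 2 * -1 * (n.+1%:R - k.+1%:R))
         * (centred_laguerre alpha n.+1 (-1) k.+1).[z].
    by rewrite ler_wpM2r ?(ltW pk1_gt0) //; move: z_ge; rewrite /centre; lra.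
  by rewrite -[k.+2%:R]natr1; lra.
have [v_gt0 le_vu] := grow n; have [u_gt0 _] := grow n.+1.
rewrite rootE !(hornerD, hornerM, hornerN, hornerX, hornerC).
rewrite (hornerZ (_ * t ^+ 2)) addr0 gt_eqF // subr_gt0.
move: u_gt0 v_gt0 le_vu z_ge; rewrite /centre.
move: (centred_laguerre _ _ _ n.+1).[z] (centred_laguerre _ _ _ n).[z].
move=> u v u_gt0 v_gt0 le_vu z_ge.
have n_gt0 : 0 < n.+1%:R :> R by rewrite ltr0n.
have c_gt0 := laguerre_coef_gt0 alpha_gt n.
apply: (@le_lt_trans _ _ (n.+1%:R * u)).
  apply: (@le_trans _ _ (n.+1%:R * (n.+1%:R + alpha) * v)).
    by rewrite ler_wpM2r ?(ltW v_gt0) // ler_piMr // ltW.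
  by rewrite -mulrA ler_wpM2l // ltW.
by rewrite ltr_pM2r //; move: c_gt0; rewrite pmulr_rgt0 //; lra.
Qed.

(** * Characterisation of the extreme zeros, and the slope of the level *)

Lemma largest_zeroE (R : realType) (p : {poly R}) (x : R) :
  root p x -> (forall y, root p y -> y <= x) -> largest_zero p = x.
Proof.
move=> rx xmax; apply: xget_unique => // y [ry ymax].
by apply/eqP; rewrite eq_le xmax ?ymax.
Qed.

Lemma smallest_zeroE (R : realType) (p : {poly R}) (x : R) :
  root p x -> (forall y, root p y -> x <= y) -> smallest_zero p = x.
Proof.
move=> rx xmin; apply: xget_unique => // y [ry ymin].
by apply/eqP; rewrite eq_le ymin ?xmin.
Qed.

(* By [level_is_derive] this is the derivative of [level], in the form of a
   Riccati equation. *)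
Definition level_slope (R : realType) (alpha : R) (n : nat) (x : R) : R :=
  let s := level alpha n x in let b := centre alpha n in
  ((1 - s) * (x - b) ^+ 2 + s * b + n%:R * (n%:R + alpha) * s ^+ 2)
  / (x * (x - b)).

(** In the quotient rule both derivatives are replaced by means of the Laguerre derivative formulas,
    which leaves a rational identity in x and the two polynomial values. *)
Lemma level_is_derive (R : realType) (alpha x : R) (n : nat) :
  -1 < alpha -> x != 0 -> x != centre alpha n.+1 ->
  (monic_laguerre alpha n).[x] != 0 ->
  is_derive x (1 : R) (level alpha n.+1) (level_slope alpha n.+1 x).
Proof.
move=> alpha_gt x_neq0 x_neqb Q_neq0; rewrite /level_slope.
set s := level _ _ x; set b := centre _ _.
have c_gt0 := laguerre_coef_gt0 alpha_gt n.
set c := n.+1%:R * _ in c_gt0 *.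
pose num := ('X - b%:P) * monic_laguerre alpha n.+1.
pose den := c *: monic_laguerre alpha n.
have denE y : den.[y] = c * (monic_laguerre alpha n).[y] by rewrite (hornerZ c).
have levelE : level alpha n.+1 = horner num * (fun y => (den.[y])^-1).
  by apply/funext => y; rewrite /level !fctE denE /num !(hornerM, hornerD, hornerN, hornerX, hornerC).
have den_neq0 : den.[x] != 0 by rewrite denE mulf_neq0 // gt_eqF.
have dden := is_deriveV den_neq0 (is_derive_poly den x).
have dlevel := is_deriveM (is_derive_poly num x) dden.
rewrite levelE; apply: is_derive_eq dlevel _.
have Pd : (monic_laguerre alpha n.+1)^`().[x] =
    (n.+1%:R * (monic_laguerre alpha n.+1).[x] + c * (monic_laguerre alpha n).[x]) / x.
  have /(congr1 (horner^~ x)) := monic_laguerre_deriv alpha n.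
  rewrite -/c hornerM hornerX hornerD (hornerZ n.+1%:R) (hornerZ c) => <-.
  by field.
have Qd : (monic_laguerre alpha n)^`().[x] =
    (x * (monic_laguerre alpha n).[x] - (n.+1%:R + alpha) * (monic_laguerre alpha n).[x]
     - (monic_laguerre alpha n.+1).[x]) / x.
  have /(congr1 (horner^~ x)) := monic_laguerre_deriv_lower alpha n.
  rewrite !hornerM !hornerD !hornerN !hornerM hornerX (hornerZ (n.+1%:R + alpha)) => <-.
  by field.
rewrite /num /den derivM derivZ derivB derivX derivC subr0 mul1r.
rewrite !(hornerD, hornerM, hornerN, hornerX, hornerC) !(hornerZ c) Pd Qd.
rewrite /s /level -/c -/b /=.
have xb_neq0 : x - b != 0 by rewrite subr_eq0.
move: Q_neq0; move: (monic_laguerre alpha n.+1).[x] (monic_laguerre alpha n).[x].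
move=> P Q Q_neq0; rewrite /GRing.scale /=.
have n1_neq0 : n.+1%:R != 0 :> R by rewrite pnatr_eq0.
have n1a_neq0 : n.+1%:R + alpha != 0.
  by move: c_gt0; rewrite /c pmulr_rgt0 ?ltr0n // => /gt_eqF ->.
rewrite /c /b /centre in xb_neq0 *; field.
by rewrite nat1r xb_neq0 x_neq0 Q_neq0 n1a_neq0 n1_neq0.
Qed.

Lemma outer_level_le (R : realType) (alpha e y y' : R) (n : nat) :
  -1 < alpha -> e ^+ 2 = 1 -> outer alpha n.+1 e y -> y <= y' -> 0 < y' ->
  outer alpha n.+1 e y' /\
  level alpha n.+1 (centre alpha n.+1 + e * y) <=
  level alpha n.+1 (centre alpha n.+1 + e * y').
Proof.
move=> alpha_gt e2 yout; rewrite le_eqVlt => /orP[/eqP<- //|lt_y] y'_gt0.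
have [||y'out /ltW //] :=
  outer_level_lt alpha_gt e2 e2 yout _ (ltW lt_y) _ y'_gt0.
- exact: lexx.
- by rewrite ltrD2l.
Qed.

(* The recurrences on the two sides differ only in the sign of the diagonal,
   which is nonpositive after centring; hence the left zero is farther away. *)
Lemma outer_right_lt_left (R : realType) (alpha w z : R) (n : nat) :
  -1 < alpha -> 0 < w -> outer alpha n.+1 1 w -> outer alpha n.+1 (-1) z ->
  level alpha n.+1 (centre alpha n.+1 + 1 * w) =
  level alpha n.+1 (centre alpha n.+1 + -1 * z) -> w < z.
Proof.
move=> alpha_gt w_gt0 wout zout eq_level; rewrite ltNge; apply/negP => le_zw.
have [||_] := outer_level_lt alpha_gt (sqrrN1 R) (expr1n R 2) zout _ le_zw _ w_gt0.
- by lra.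
- by lra.
by rewrite eq_level ltxx.
Qed.

(** For a = p / x the sum is x times the derivative of S(x) - S(p / x). At a common level s it
    equals -(z - w)((1 - s) w z - (s b + c s^2)) / (w z). *)
Lemma level_slope_sum_lt0 (R : realType) (alpha w z : R) (n : nat) :
  -1 < alpha -> (4 <= n)%N -> outer alpha n.+1 1 w -> outer alpha n.+1 (-1) z ->
  let x := centre alpha n.+1 + 1 * w in let a := centre alpha n.+1 + -1 * z in
  0 < a -> level alpha n.+1 x = level alpha n.+1 a ->
  level alpha n.+1 x <= 12 / 37 ->
  x * level_slope alpha n.+1 x + a * level_slope alpha n.+1 a < 0.
Proof.
move=> alpha_gt n_ge4 wout zout x a a_gt0 eq_level.
have w_gt0 : 0 < w by apply: (outer_right_gt0 alpha_gt) wout.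
have z_gt0 : 0 < z by apply: (@lt_trans _ _ 4) => //; apply: (outer_left_gt4 alpha_gt) zout.
have lt_wz := outer_right_lt_left alpha_gt w_gt0 wout zout eq_level.
have wz_gt := @outer_mul_gt _ _ _ _ n.+1 alpha_gt n_ge4 wout zout.
have s_ge0 : 0 <= level alpha n.+1 x.
  rewrite /x level_centred ?expr1n // divr_ge0 //.
    by rewrite mulr_ge0 ?(ltW w_gt0) // wout.
  by rewrite mulr_ge0 ?wout // ltW // laguerre_coef_gt0.
rewrite /level_slope -eq_level; move: (level _ _ x) s_ge0 => s s_ge0 s_le.
have x_gt0 : 0 < x by rewrite /x; rewrite /a in a_gt0; lra.
have c_gt0 := laguerre_coef_gt0 alpha_gt n.
have b_gt0 : 0 < centre alpha n.+1 by rewrite /a in a_gt0; lra.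
have xbE : x - centre alpha n.+1 = w by rewrite /x; ring.
have abE : a - centre alpha n.+1 = - z by rewrite /a; ring.
rewrite xbE abE; clear eq_level xbE abE; clearbody x a.
move: (n.+1%:R * _) (centre alpha n.+1) c_gt0 b_gt0 wz_gt => c b c_gt0 b_gt0 wz_gt.
have wz_gt0 : 0 < w * z by rewrite mulr_gt0.
have s2_le : s ^+ 2 <= 144 / 1369.
  by rewrite (_ : 144 / 1369 = (12 / 37) ^+ 2) ?ler_pXn2r ?nnegrE //; [lra|field].
(* At s = 12/37 this is [wz_gt] divided by 37^2; for smaller s the left side decreases and the right
   side increases. *)
have lt_K : s * b + c * s ^+ 2 < (1 - s) * (w * z).
  have : s * b <= 12 / 37 * b by rewrite ler_pM2r.
  have : c * s ^+ 2 <= c * (144 / 1369) by rewrite ler_pM2l.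
  have : (1 - 12 / 37) * (w * z) <= (1 - s) * (w * z) by rewrite ler_pM2r //; lra.
  by lra.
have -> : x * (((1 - s) * w ^+ 2 + s * b + c * s ^+ 2) / (x * w))
    + a * (((1 - s) * (- z) ^+ 2 + s * b + c * s ^+ 2) / (a * - z)) =
    - ((z - w) * ((1 - s) * (w * z) - (s * b + c * s ^+ 2)) / (w * z)).
  by field; rewrite !gt_eqF.
by rewrite oppr_lt0 divr_gt0 // mulr_gt0 // subr_gt0.
Qed.

(** * Functions with negative derivative at each of their zeros *)

Lemma derive_lt0_secant (R : realType) (f : R -> R) (x l : R) :
  is_derive x (1 : R) f l -> l < 0 ->
  exists2 d, 0 < d & forall h, h != 0 -> `|h| < d -> (f (x + h) - f x) / h < 0.
Proof.
move=> [df <-] l_lt0.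
have /nbhs_ballP[d d_gt0 dP] : nbhs (0 : R) (fun h : R => h != 0 ->
    h^-1 *: ((f \o shift x) (h *: (1 : R)) - f x) < 0).
  exact: (cvgr_lt _ df _ l_lt0).
exists d => // h h_neq0 lt_hd.
have := dP h; rewrite /= /ball /= sub0r normrN => /(_ lt_hd h_neq0).
by rewrite /GRing.scale /= mulr1 [h + x]addrC mulrC.
Qed.

(** Consider the first return c to nonnegative values. Continuity excludes f(c) < 0 and f(c) > 0,
    and f(c) = 0 would make f positive just before c, where it is negative. *)
Lemma derive_lt0_at_zeros (R : realType) (f df : R -> R) (a b : R) :
  a < b -> (forall x, a <= x <= b -> is_derive x (1 : R) f (df x)) ->
  (forall x, a <= x <= b -> f x = 0 -> df x < 0) -> f a = 0 -> f b < 0.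
Proof.
move=> lt_ab fdf df_lt0 fa0; rewrite ltNge; apply/negP => fb_ge0.
(* The point [a] is left out because f vanishes there. *)
pose E := [set x | a < x <= b /\ 0 <= f x]%classic.
have Eb : E b by rewrite /E /= lt_ab lexx.
have E_lb : lbound E a by move=> x [/andP[/ltW]].
have E_inf : has_inf E by split; [exists b | exists a].
pose c := inf E.
have le_cE x : E x -> c <= x by move=> Ex; apply: ge_inf => //; exists a.
have ge_c x : lbound E x -> x <= c by move=> xE; apply: lb_le_inf => //; exists b.
have f_lt0 x : a < x -> x < c -> f x < 0.
  move=> lt_ax lt_xc; rewrite ltNge; apply/negP => fx_ge0.
  have /le_cE : E x; last by rewrite leNgt lt_xc.
  by split=> //; rewrite lt_ax ltW // (lt_le_trans lt_xc) // le_cE.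
(* The negative derivative at the zero [a] makes f negative just to its right. *)
have lt_ac : a < c.
  have aab : a <= a <= b by rewrite lexx ltW.
  have [d d_gt0 dP] := derive_lt0_secant (fdf a aab) (df_lt0 a aab fa0).
  apply: (@lt_le_trans _ _ (a + d)); first by rewrite ltrDl.
  apply: ge_c => x [/andP[lt_ax le_xb] fx_ge0]; rewrite leNgt; apply/negP => lt_xd.
  have xa_gt0 : 0 < x - a by rewrite subr_gt0.
  have := dP (x - a); rewrite gt_eqF // gtr0_norm // ltrBlDl => /(_ isT lt_xd).
  by rewrite [a + _]addrC subrK fa0 subr0 ltNge divr_ge0 // ltW.
have le_cb : c <= b by apply: le_cE.
have acb : a <= c <= b by rewrite le_cb ltW.
have cts : {for c, continuous f}.
  by have [df_c _] := fdf c acb; apply/differentiable_continuous/derivable1_diffP.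
have [fc_lt0|fc_gt0|fc0] := ltrgtP (f c) 0.
- have /nbhs_ballP[d d_gt0 dP] : nbhs c (fun x => f x < 0).
    exact: (cvgr_lt _ cts _ fc_lt0).
  have : c + d <= c; last by rewrite leNgt ltrDl d_gt0.
  apply: ge_c => x Ex; rewrite leNgt; apply/negP => lt_xd.
  have := dP x; rewrite /ball /= distrC ger0_norm ?subr_ge0 ?le_cE // ltrBlDl.
  by move=> /(_ lt_xd); case: Ex => _; rewrite leNgt => /negP.
- have /nbhs_ballP[d d_gt0 dP] : nbhs c (fun x => 0 < f x).
    exact: (cvgr_gt _ cts _ fc_gt0).
  rewrite /= in d_gt0.
  (* The maximum with the midpoint keeps x inside ]a, c[, where f < 0, even when d exceeds c - a. *)
  pose x := Num.max ((a + c) / 2) (c - d / 2).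
  have lt_xc : x < c by rewrite gt_max; apply/andP; split; lra.
  have lt_ax : a < x by rewrite lt_max; apply/orP; left; lra.
  have lt_dx : c - d < x by rewrite lt_max; apply/orP; right; lra.
  have := dP x; rewrite /ball /= gtr0_norm ?subr_gt0 // ltrBlDr -ltrBlDl.
  by move=> /(_ lt_dx); rewrite ltNge => /negP; apply; rewrite ltW // f_lt0.
- have [d d_gt0 dP] := derive_lt0_secant (fdf c acb) (df_lt0 c acb fc0).
  pose x := Num.max ((a + c) / 2) (c - d / 2).
  have lt_xc : x < c by rewrite gt_max; apply/andP; split; lra.
  have lt_ax : a < x by rewrite lt_max; apply/orP; left; lra.
  have lt_dx : c - d < x by rewrite lt_max; apply/orP; right; lra.
  have xc_lt0 : x - c < 0 by rewrite subr_lt0.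
  have := dP (x - c); rewrite lt_eqF // ltr0_norm // opprB => /(_ isT).
  rewrite [c + (x - c)]addrC subrK fc0 subr0 => H; have : f x / (x - c) < 0 by apply: H; lra.
  by rewrite ltNge mulr_le0 // ?invr_le0 ltW // f_lt0.
Qed.

(** * Differentiability at outer points, and monotonicity of the product *)

Lemma outer_monic_neq0 (R : realType) (alpha e y : R) (n : nat) :
  -1 < alpha -> e ^+ 2 = 1 -> outer alpha n.+1 e y ->
  (monic_laguerre alpha n).[centre alpha n.+1 + e * y] != 0.
Proof.
move=> alpha_gt e2 yout; have := outer_gt0 alpha_gt e2 yout (ltnSn n).
rewrite horner_centred_laguerre; case: eqP => // ->.
by rewrite mulr0 ltxx.
Qed.

Lemma outer_level_is_derive (R : realType) (alpha e y : R) (n : nat) :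
  -1 < alpha -> e ^+ 2 = 1 -> outer alpha n.+1 e y -> 0 < y ->
  let x := centre alpha n.+1 + e * y in 0 < x ->
  is_derive x (1 : R) (level alpha n.+1) (level_slope alpha n.+1 x).
Proof.
move=> alpha_gt e2 yout y_gt0 x x_gt0; apply: level_is_derive => //.
- by rewrite gt_eqF.
- rewrite -subr_eq0 /x addrAC subrr add0r mulf_neq0 ?(gt_eqF y_gt0) //.
  by rewrite -sqrf_eq0 e2 oner_neq0.
- exact: outer_monic_neq0.
Qed.

Lemma outer_eq_level_lt (R : realType) (alpha e y y' : R) (n : nat) :
  -1 < alpha -> e ^+ 2 = 1 -> 0 < y -> outer alpha n.+1 e y' ->
  level alpha n.+1 (centre alpha n.+1 + e * y) <
  level alpha n.+1 (centre alpha n.+1 + e * y') -> y < y'.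
Proof.
move=> alpha_gt e2 y_gt0 y'out; apply: contraTT; rewrite -!leNgt => le_y.
by have [] := outer_level_le alpha_gt e2 y'out le_y y_gt0.
Qed.

Lemma is_derive_sub_comp_div (R : realType) (f g : R -> R) (p x df dg : R) :
  x != 0 -> is_derive x (1 : R) f df -> is_derive (p / x) (1 : R) g dg ->
  is_derive x (1 : R) (fun y => f y - g (p / y)) (df + dg * (p / x ^+ 2)).
Proof.
move=> x_neq0 dfx dgx.
have dp : is_derive x (1 : R) (fun y : R => p / y) (- (p / x ^+ 2)).
  have dinv := @is_deriveV _ id x 1 1 x_neq0 (is_derive_id _ _).
  apply: (is_derive_eq (is_deriveZ p dinv)).
  by rewrite /GRing.scale /= mulr1 mulrN.
have dsub := is_deriveB dfx (@is_derive1_comp _ g (fun y => p / y) _ _ _ dgx dp).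
by apply: is_derive_eq dsub _; rewrite mulrN opprK.
Qed.

(* 47 + 96 / 10 ^+ 2 + 3 / 10 ^+ 4 is 47.9603 and
   568 / 10 ^+ 3 + 774 / 10 ^+ 6 is 0.568774; a literal such as 568774 would be
   read as a unary natural number. *)
Theorem proposition1p1 (R : realType) (alpha : R) (n : nat)
    (alpha_gt : -1 < alpha)
    (alpha_le : alpha <= 47 + 96 / 10 ^+ 2 + 3 / 10 ^+ 4)
    (n_ge5 : (5 <= n)%N) :
  {in `[0, 568 / 10 ^+ 3 + 774 / 10 ^+ 6] &,
    {homo (fun t : R =>
             smallest_zero (perturbed_laguerre alpha n t)
             * largest_zero (perturbed_laguerre alpha n t))
      : s t / s < t}}.
Proof.
case: n n_ge5 => // n n_ge4 s t.
rewrite !in_itv /= => /andP[s_ge0 _] /andP[t_ge0 t_le] lt_st.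
(* The rounding to 569/1000 is harmless: 0.569^2 is still below 12/37. *)
have t2_le : t ^+ 2 <= 12 / 37.
  have : t <= 569 / 1000 by lra.
  by move=> t_le'; nra.
have lt_st2 : s ^+ 2 < t ^+ 2 by rewrite ltr_pXn2r ?nnegrE.
have e1 := expr1n R 2; have eN1 := sqrrN1 R.
set b := centre alpha n.+1.
have extremes u : exists w z, [/\ outer alpha n.+1 1 w, outer alpha n.+1 (-1) z,
    level alpha n.+1 (b + 1 * w) = u ^+ 2,
    level alpha n.+1 (b + -1 * z) = u ^+ 2 &
    [/\ smallest_zero (perturbed_laguerre alpha n.+1 u) = b + -1 * z,
        largest_zero (perturbed_laguerre alpha n.+1 u) = b + 1 * w &
        u ^+ 2 <= 1 -> 0 < b + -1 * z]].
  have [w [rw wmax wout]] := extreme_zero_exists u n alpha_gt e1.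
  have [z [rz zmax zout]] := extreme_zero_exists u n alpha_gt eN1.
  exists w, z; split=> //; [exact: level_root|exact: level_root|split].
  - apply: smallest_zeroE => // y ry; have := zmax (b - y).
    have -> : b + -1 * (b - y) = y by ring.
    by move=> /(_ ry); rewrite -/b; lra.
  - apply: largest_zeroE => // y ry; have := wmax (y - b).
    have -> : b + 1 * (y - b) = y by ring.
    by move=> /(_ ry); rewrite -/b; lra.
  - by move=> u2_le1; apply: root_perturbed_laguerre_gt0 rz.
have [ws [zs [wsout zsout lws lzs [-> -> a_gt0]]]] := extremes s.
have [wt [zt [wtout ztout lwt lzt [-> -> a'_gt0]]]] := extremes t.
have {}a_gt0 : 0 < b + -1 * zs by apply: a_gt0; lra.
have {}a'_gt0 : 0 < b + -1 * zt by apply: a'_gt0; lra.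
have right_gt0 w : outer alpha n.+1 1 w -> 0 < w by apply: outer_right_gt0.
have left_gt0 z : outer alpha n.+1 (-1) z -> 0 < z.
  by move=> zout; apply: (@lt_trans _ _ 4) => //; apply: (outer_left_gt4 alpha_gt) zout.
have ws_gt0 := right_gt0 _ wsout; have zs_gt0 := left_gt0 _ zsout.
have wt_gt0 := right_gt0 _ wtout; have zt_gt0 := left_gt0 _ ztout.
have lt_w : ws < wt by apply: (@outer_eq_level_lt _ alpha 1 _ _ n) => //; rewrite -/b lws lwt.
set x0 := b + 1 * ws; set x1 := b + 1 * wt; set a0 := b + -1 * zs in a_gt0 *.
have b_gt0 : 0 < b by rewrite /a0 in a_gt0; lra.
have x0_gt0 : 0 < x0 by rewrite /x0; lra.
have lt_x : x0 < x1 by rewrite /x0 /x1; lra.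
pose p := a0 * x0; have p_gt0 : 0 < p by rewrite mulr_gt0.
(* Along the curve of pairs with product p, psi is the difference of the two levels; it vanishes at
   x0, where both members are zeros for parameter s. *)
pose psi x := level alpha n.+1 x - level alpha n.+1 (p / x).
pose dpsi x := (x * level_slope alpha n.+1 x
  + p / x * level_slope alpha n.+1 (p / x)) / x.
(* As x moves right from x0, p / x moves left from a0, so both stay outer; the level at x is at most
   its value t^2 at x1. *)
have on_path x : x0 <= x <= x1 ->
    [/\ outer alpha n.+1 1 (x - b), outer alpha n.+1 (-1) (b - p / x),
        0 < p / x & level alpha n.+1 x <= t ^+ 2].
  move=> /andP[le_x0 le_x1]; have x_gt0 := lt_le_trans x0_gt0 le_x0.
  have le_a0 : p / x <= a0 by rewrite ler_pdivrMr // ler_pM2l.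
  have [||wout _] := @outer_level_le _ alpha 1 ws (x - b) n alpha_gt e1 wsout.
  - by rewrite /x0 in le_x0; lra.
  - by rewrite /x0 in le_x0; lra.
  have [||zout _] := @outer_level_le _ alpha (-1) zs (b - p / x) n alpha_gt eN1 zsout.
  - by rewrite /a0 in le_a0; lra.
  - by rewrite /a0 in le_a0; lra.
  split=> //; first exact: divr_gt0.
  have [|_] := @outer_level_le _ alpha 1 (x - b) wt n alpha_gt e1 wout _ wt_gt0.
    by rewrite /x1 in le_x1; lra.
  by rewrite -/b lwt (_ : b + 1 * (x - b) = x) //; ring.
have xE x : x = b + 1 * (x - b) by ring.
have aE x : x = b + -1 * (b - x) by ring.
have psi1_lt0 : psi x1 < 0.
  apply: (@derive_lt0_at_zeros _ psi dpsi x0 x1) => [//|x xI|x xI psi0|].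
  - have [wout zout px_gt0 _] := on_path x xI.
    have x_gt0 : 0 < x by case/andP: xI => /(lt_le_trans x0_gt0).
    have dx : is_derive x (1 : R) (level alpha n.+1) (level_slope alpha n.+1 x).
      have := outer_level_is_derive alpha_gt e1 wout (right_gt0 _ wout).
      by rewrite /= -/b -xE; apply.
    have da : is_derive (p / x) (1 : R) (level alpha n.+1)
        (level_slope alpha n.+1 (p / x)).
      have := outer_level_is_derive alpha_gt eN1 zout (left_gt0 _ zout).
      by rewrite /= -/b -aE; apply.
    apply: (is_derive_eq (is_derive_sub_comp_div (lt0r_neq0 x_gt0) dx da)).
    by rewrite /dpsi; field; rewrite gt_eqF.
  - have [wout zout px_gt0 le_t2] := on_path x xI.
    have x_gt0 : 0 < x by case/andP: xI => /(lt_le_trans x0_gt0).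
    rewrite /dpsi ltr_pdivrMr // mul0r.
    have := level_slope_sum_lt0 alpha_gt n_ge4 wout zout.
    rewrite /= -/b -xE -aE; apply=> //; last exact: le_trans le_t2 t2_le.
    by apply/eqP; rewrite -subr_eq0; apply/eqP.
  - by rewrite /psi /p mulfK ?gt_eqF // lws lzs subrr.
have [|_ zout px_gt0 _] := on_path x1; first by rewrite lexx ltW.
move: psi1_lt0; rewrite /psi subr_lt0 lwt => lt_level.
(* The level at p / x1 exceeds t^2, its value at the smallest zero for t, so p / x1 lies to the left
   of that zero; multiplying by x1 gives the claim. *)
have lt_z : zt < b - p / x1.
  apply: (@outer_eq_level_lt _ alpha (-1) _ _ n) => //.
  by rewrite -/b lzt -aE.
rewrite -/p -ltr_pdivrMr; last exact: lt_trans lt_x.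
by lra.
Qed.
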